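(* In the setting and notation of the context (constant coefficients $A=I$, $V=1$, $\beta=1$), suppose that $\Omega$ is star-shaped with respect to a ball, that the mesh size satisfies $h\sim k^{-(1+\gamma)}$ for some $\gamma\in(0,1]$, and that $$\lambda^{1/2}_{h,i,n_i+1}\sim\big(kC_{\rm stab}(k)\big)^{-1},\qquad H_i^*\sim k^{-1}\qquad\text{for all } i=1,\dots,N.$$ Then the quantity $$\Lambda\sim\sqrt{\xi\,\widetilde\xi^{*}}\;C_{\mathcal B}\,(kh)^{-1/2}\max_{i=1,\dots,N}\Big(\big(1+kC_{{\rm stab},i}(k)\big)\big(1+(kH_i^{*})^{-1}\big)^{3/2}\lambda_{h,i,n_i+1}^{1/2}\Big)$$ satisfies $$\Lambda\sim k^{\gamma/2}\lambda_{\max}^{1/2}\sim\big(\lambda_{\max}^{1/2}\big)^{1-\gamma/2}\sim k^{-1+\gamma/2}.$$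
   Context: **Helmholtz problem.** $\Omega\subset\mathbb R^d$ ($d=2,3$) is a bounded Lipschitz domain with polygonal boundary; $k>0$ is the wavenumber (regime of large $k$). All function spaces are complex. Put $\mathcal B(u,v)=\int_\Omega(\nabla u\cdot\nabla\bar v-k^2u\bar v)\,dx-{\rm i}k\int_{\partial\Omega}u\bar v\,ds$. For a subdomain $\omega\subset\Omega$: $\mathcal B_\omega(u,v)=\int_\omega(\nabla u\cdot\nabla\bar v-k^2u\bar v)\,dx-{\rm i}k\int_{\partial\omega\cap\partial\Omega}u\bar v\,ds$; $\mathcal B_{\omega,\rm imp}(u,v)=\mathcal B_\omega(u,v)-{\rm i}k\int_{\partial\omega\cap\Omega}u\bar v\,ds$; $\mathcal A_\omega(u,v)=\int_\omega\nabla u\cdot\nabla\bar v\,dx$; $\mathcal A_{\omega,k}(u,v)=\int_\omega(\nabla u\cdot\nabla\bar v+k^2u\bar v)\,dx$; $\|u\|_{\mathcal A,\omega,k}=\mathcal A_{\omega,k}(u,u)^{1/2}$, with $\omega$ dropped when $\omega=\Omega$. $C_{\mathcal B}>0$ is a $k$-independent constant with $|\mathcal B(u,v)|\le C_{\mathcal B}\|u\|_{\mathcal A,k}\|v\|_{\mathcal A,k}$ on $H^1(\Omega)$. $C_{\rm stab}(k)$ is the stability constant in $\|u\|_{\mathcal A,k}\le C_{\rm stab}(k)\|f\|_{L^2(\Omega)}$, where $f\in L^2(\Omega)$ and $u\in H^1(\Omega)$ solves $\mathcal B(u,v)=\int_\Omega f\bar v\,dx$ for all $v\in H^1(\Omega)$;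 for star-shaped $\Omega$ (with respect to a ball) one has $C_{\rm stab}(k)\sim1$, and this is the value used. **Discretization and decomposition.** $\{\tau_h\}$ is a shape-regular family of triangulations of $\Omega$ with mesh size $h$; $U_h(\Omega)\subset H^1(\Omega)$ is the Lagrange space of continuous piecewise polynomials of degree $p$; $I_h$ is nodal interpolation. $\{\omega_i\}_{i=1}^N$ is an overlapping decomposition of $\Omega$, each $\omega_i$ a union of elements; $\omega_i^*\supset\omega_i$ is $\omega_i$ plus several layers of adjacent elements, assumed Lipschitz; $\widetilde\omega_i^*$ is the union of all $K\in\tau_h$ with $\overline K\cap\overline{\omega_i^*}\neq\emptyset$; $H_i^*={\rm diam}(\omega_i^* )$. $\xi=\max_{x\in\Omega}\#\{i:x\in\omega_i\}$ and $\widetilde\xi^*=\max_{x\in\Omega}\#\{i:x\in\widetilde\omega_i^*\}$, which are bounded uniformly in $k,h$. $U_h(\omega_i^* )=\{v_h|_{\omega_i^*}:v_h\in U_h(\Omega)\}$; $U_{h,0}(\omega_i^* )=\{v_h\in U_h(\omega_i^* ):v_h=0\text{ on }\partial\omega_i^*\cap\Omega\}$; $U_{h,\mathcal B}(\omega_i^* )=\{u_h\in U_h(\omega_i^* ):\mathcal B_{\omega_i^*}(u_h,v_h)=0\ \forall v_h\in U_{h,0}(\omega_i^* )\}$. $\{\chi_i\}$ is a partition of unity: $0\le\chi_i\le1$, ${\rm supp}\,\chi_i\subseteq\overline{\omega_i}$, $\sum_i\chi_i=1$, $\chi_i\in W^{1,\infty}(\omega_i)$, $\|\nabla\chi_i\|_{L^\infty(\omega_i)}\le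 C_\chi/{\rm diam}(\omega_i)$. $C_{{\rm stab},i}(k)>0$ is the constant in the local discrete inf-sup condition (assumed for $0<h<h_0$) $\inf_{v_h\in U_h(\omega_i^* )}\sup_{0\ne u_h\in U_h(\omega_i^* )}\frac{|\mathcal B_{\omega_i^*,\rm imp}(v_h,u_h)|}{\|v_h\|_{\mathcal A,\omega_i^*,k}\|u_h\|_{\mathcal A,\omega_i^*,k}}\gtrsim\frac1{1+kC_{{\rm stab},i}(k)}$; when $H_i^*\sim k^{-1}$ it satisfies $C_{{\rm stab},i}(k)\sim k^{-1}$, and this is the value used. **Eigenvalues.** For each $i$, $\lambda_{h,i,1}\ge\lambda_{h,i,2}\ge\dots$ are the eigenvalues of: find $\phi_h\in U_{h,\mathcal B}(\omega_i^* )$, $\lambda_h\in\mathbb R$ with $\mathcal A_{\omega_i^*,k}(I_h(\chi_i\phi_h),I_h(\chi_iv_h))=\lambda_h\,\mathcal A_{\omega_i^*}(\phi_h,v_h)$ for all $v_h\in U_{h,\mathcal B}(\omega_i^* )$. $n_i$ is the number of eigenfunctions used on $\omega_i$, and $\lambda_{\max}=\max_i\lambda_{h,i,n_i+1}$. **Role of $\Lambda$.** $\Lambda$ is the bound for the relative error (in $\|\cdot\|_{\mathcal A,k}$) of the multiscale spectral generalized FEM approximation built from these eigenfunctions with local impedance problems, and for the convergence rate of the corresponding two-level iteration. **Constants.** $a\lesssim b$ means $a\le Cb$ with $C>0$ independent of $h$, $k$ and the size of the oversampling domains; $a\sim b$ means $a\lesssim b$ and $b\lesssim a$. *)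

(* Defs.v *)
From HB Require Import structures.
From mathcomp Require Import all_boot all_order all_algebra.
From mathcomp Require Import all_classical all_reals all_analysis.
From mathcomp Require Import complex.

Set Implicit Arguments.
Unset Strict Implicit.
Unset Printing Implicit Defensive.

Import Order.TTheory GRing.Theory Num.Theory.
Import numFieldNormedType.Exports.

Local Open Scope classical_set_scope.
Local Open Scope ring_scope.
Local Open Scope complex_scope.

(* An instance of [I] collects all the parameters (wavenumber, mesh, subdomain)
   of which the constant must be independent. *)
Definition lesssim (R : realType) (I : Type) (a b : I -> R) : Prop :=
  exists2 C : R, 0 < C & forall i, a i <= C * b i.

Definition asymp (R : realType) (I : Type) (a b : I -> R) : Prop :=
  lesssim a b /\ lesssim b a.

(* The library norm on ['rV[R]_d] is the maximum norm; it is used here only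
   through its topology.  Lengths are measured with [enorm]. *)

Section Measures.
Context (R : realType).

Definition dotp d (x y : 'rV[R]_d) : R := \sum_j x 0 j * y 0 j.

Definition enorm d (x : 'rV[R]_d) : R := Num.sqrt (dotp x x).

Definition eball d (x : 'rV[R]_d) (r : R) : set 'rV[R]_d :=
  [set y | enorm (y - x) < r].

Definition bounded d (A : set 'rV[R]_d) : Prop :=
  exists r : R, A `<=` eball 0 r.

Definition ediam d (A : set 'rV[R]_d) : \bar R :=
  ereal_sup [set (enorm (x - y))%:E | x in A & y in A].

Definition diam d (A : set 'rV[R]_d) : R := fine (ediam A).

Definition boundary d (A : set 'rV[R]_d) : set 'rV[R]_d :=
  closure A `\` A°.

(* infimum of the total gauge of the countable covers of A by sets [S i],
   with [i] in [C] *)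
Definition cover_measure (T I : Type) (C : set I) (S : I -> set T)
    (g : I -> \bar R) (A : set T) : \bar R :=
  ereal_inf [set (\sum_(0 <= n <oo) g (F n))%E | F in
    [set F : nat -> I | (forall n, C (F n)) /\ A `<=` \bigcup_n S (F n)]].

Definition box d (ab : 'rV[R]_d * 'rV[R]_d) : set 'rV[R]_d :=
  [set x | forall j, ab.1 0 j <= x 0 j <= ab.2 0 j].

Definition box_volume d (ab : 'rV[R]_d * 'rV[R]_d) : \bar R :=
  (\prod_j Num.max 0 (ab.2 0 j - ab.1 0 j))%:E.

Definition leb d : set 'rV[R]_d -> \bar R :=
  cover_measure setT (@box d) (@box_volume d).

(* s-dimensional Hausdorff measure for an integer s >= 1.  The factor is the
   Lebesgue measure of the s-dimensional ball of diameter 1, so that the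
   surface measure of flat pieces is the usual one. *)
Definition hausdorff d (s : nat) (A : set 'rV[R]_d) : \bar R :=
  ereal_sup [set cover_measure
      [set S | (ediam S <= delta%:E)%E] id
      (fun S => (leb [set x : 'rV[R]_s | (enorm x <= 2^-1)%R] *
                 (diam S ^+ s)%:E)%E) A
    | delta in [set delta : R | 0 < delta]].

Definition surf d : set 'rV[R]_d -> \bar R := hausdorff d.-1.

Definition borel d := g_sigma_algebraType (@open 'rV[R]_d).

Definition eint d (mu : set 'rV[R]_d -> \bar R) (D : set 'rV[R]_d)
    (f : 'rV[R]_d -> R) : \bar R :=
  @integral _ (borel d) R mu D (fun x => (f x)%:E).

Definition cint d (mu : set 'rV[R]_d -> \bar R) (D : set 'rV[R]_d)
    (f : 'rV[R]_d -> R[i]) : R[i] :=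
  fine (eint mu D (fun x => complex.Re (f x)))
  +i* fine (eint mu D (fun x => complex.Im (f x))).

Definition cabs (z : R[i]) : R := complex.Re `|z|.

Definition L2sq d (mu : set 'rV[R]_d -> \bar R) (D : set 'rV[R]_d)
    (f : 'rV[R]_d -> R[i]) : \bar R := eint mu D (fun x => cabs (f x) ^+ 2).

Definition L2 d (mu : set 'rV[R]_d -> \bar R) (D : set 'rV[R]_d)
    (f : 'rV[R]_d -> R[i]) : Prop :=
  [/\ @measurable_fun _ _ (borel d) R D (fun x => complex.Re (f x)),
      @measurable_fun _ _ (borel d) R D (fun x => complex.Im (f x)) &
      (L2sq mu D f < +oo)%E].

Definition L2norm d (mu : set 'rV[R]_d -> \bar R) (D : set 'rV[R]_d)
    (f : 'rV[R]_d -> R[i]) : R := Num.sqrt (fine (L2sq mu D f)).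

End Measures.

Section Sobolev.
Context (R : realType) (d : nat).
Local Notation pt := 'rV[R]_d.
Local Notation C := R[i].

Definition partial (j : 'I_d) (f : pt -> R) : pt -> R :=
  fun x => 'D_(delta_mx 0 j) f x.

Fixpoint Cn (n : nat) (f : pt -> R) : Prop :=
  continuous f /\
  if n is m.+1 then
    forall j : 'I_d, (forall x, derivable f x (delta_mx 0 j)) /\
                     Cn m (partial j f)
  else True.

Definition test_function (w : set pt) (phi : pt -> R) : Prop :=
  [/\ forall n, Cn n phi,
      compact (closure [set x | phi x != 0]) &
      closure [set x | phi x != 0] `<=` w].

(* [g x j] is the j-th component at x of the weak gradient, in L^2(w) *)
Definition is_grad (w : set pt) (u : pt -> C) (g : pt -> 'I_d -> C) : Prop :=
  (forall j, L2 (@leb R d) w (g ^~ j)) /\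
  forall phi, test_function w phi -> forall j,
    cint (@leb R d) w (fun x => u x * (partial j phi x)%:C) =
    - cint (@leb R d) w (fun x => g x j * (phi x)%:C).

Definition H1 (w : set pt) (u : pt -> C) : Prop :=
  L2 (@leb R d) w u /\ exists g, is_grad w u g.

(* the weak gradient is unique up to a null set; this picks a representative *)
Definition grad (w : set pt) (u : pt -> C) : pt -> 'I_d -> C :=
  xget (fun _ _ => 0) [set g | is_grad w u g].

Definition cgrad (f : pt -> C) : pt -> 'I_d -> C := fun x j =>
  partial j (fun y => complex.Re (f y)) x
  +i* partial j (fun y => complex.Im (f y)) x.

(* The trace on the boundary of a Lipschitz set w is the continuous extension
   to H^1(w) of the restriction to the boundary, defined on C^1 functions on
   the whole space (which are dense in H^1(w)). *)
Definition is_trace (w : set pt) (u t : pt -> C) : Prop :=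
  L2 (@surf R d) (boundary w) t /\
  exists f : nat -> pt -> C,
    [/\ forall n, Cn 1 (fun x => complex.Re (f n x)) /\
                  Cn 1 (fun x => complex.Im (f n x)),
        L2sq (@leb R d) w (fun x => f n x - u x) @[n --> \oo] --> 0%E,
        forall j, L2sq (@leb R d) w (fun x => cgrad (f n) x j - grad w u x j)
                    @[n --> \oo] --> 0%E &
        L2sq (@surf R d) (boundary w) (fun x => f n x - t x)
          @[n --> \oo] --> 0%E].

Definition trace (w : set pt) (u : pt -> C) : pt -> C :=
  xget (fun _ => 0) [set t | is_trace w u t].

(* In the forms, [Om] is the whole domain and [w] a subdomain; B itself is
   [helmB Om k Om]. *)

Definition grad_dot (w : set pt) (u v : pt -> C) (x : pt) : C :=
  \sum_j grad w u x j * (grad w v x j)^*.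

Definition helmA (w : set pt) (u v : pt -> C) : C :=
  cint (@leb R d) w (grad_dot w u v).

Definition helmAk (k : R) (w : set pt) (u v : pt -> C) : C :=
  cint (@leb R d) w
    (fun x => grad_dot w u v x + (k ^+ 2)%:C * (u x * (v x)^*)).

Definition normAk (k : R) (w : set pt) (u : pt -> C) : R :=
  Num.sqrt (complex.Re (helmAk k w u u)).

Definition bdry_int (w S : set pt) (u v : pt -> C) : C :=
  cint (@surf R d) S (fun x => trace w u x * (trace w v x)^*).

Definition helmB (Om : set pt) (k : R) (w : set pt) (u v : pt -> C) : C :=
  cint (@leb R d) w
    (fun x => grad_dot w u v x - (k ^+ 2)%:C * (u x * (v x)^*))
  - (0 +i* k) * bdry_int w (boundary w `&` boundary Om) u v.

Definition helmBimp (Om : set pt) (k : R) (w : set pt) (u v : pt -> C) : C :=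
  helmB Om k w u v - (0 +i* k) * bdry_int w (boundary w `&` Om) u v.

(* Near each boundary point, w is the part above the graph, in a direction
   [nu], of a Lipschitz function of the coordinates orthogonal to [nu]. *)
Definition lipschitz_set (w : set pt) : Prop :=
  [/\ open w, bounded w &
      forall x, boundary w x -> exists r L : R, exists nu : pt,
        exists zeta : pt -> R,
        [/\ 0 < r, enorm nu = 1,
            forall y z, `|zeta y - zeta z| <= L * enorm (y - z) &
            forall y, eball x r y ->
              (w y <-> zeta (y - dotp y nu *: nu) < dotp y nu)]].

(* For d = 3, a polyhedral boundary. *)
Definition polygonal_boundary (w : set pt) : Prop :=
  exists m : nat, exists a : 'I_m -> pt, exists b : 'I_m -> R,
    (forall l, a l != 0) /\
    boundary w `<=` [set x | exists l, dotp (a l) x = b l].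

Definition polygonal_lipschitz_domain (w : set pt) : Prop :=
  [/\ w !=set0, connected w, lipschitz_set w & polygonal_boundary w].

Definition star_shaped_wrt_ball (w : set pt) : Prop :=
  exists x0 : pt, exists2 r : R, 0 < r &
    eball x0 r `<=` w /\
    forall y x t, eball x0 r y -> w x -> 0 <= t <= 1 ->
      w ((1 - t) *: y + t *: x).

(* A simplex is given by its d + 1 vertices. *)
Definition simplex := 'I_d.+1 -> pt.

(* convex hull of the vertices of K with index in S *)
Definition face (K : simplex) (S : {set 'I_d.+1}) : set pt :=
  [set x | exists a : 'I_d.+1 -> R,
    [/\ forall l, 0 <= a l, \sum_l a l = 1,
        forall l, l \notin S -> a l = 0 & x = \sum_l a l *: K l]].

Definition hull (K : simplex) : set pt := face K finset.setT.

Definition nondegenerate (K : simplex) : Prop :=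
  forall a : 'I_d.+1 -> R,
    \sum_l a l = 0 -> \sum_l a l *: K l = 0 -> forall l, a l = 0.

Definition common_vertices (K K' : simplex) : {set 'I_d.+1} :=
  finset (fun l => [exists l', K l == K' l']).

Definition triangulation (Om : set pt) (M : nat) (T : 'I_M -> simplex) : Prop :=
  [/\ forall e, nondegenerate (T e),
      closure Om = \bigcup_e hull (T e),
      forall e e', e != e' -> common_vertices (T e) (T e') != finset.setT &
      forall e e', hull (T e) `&` hull (T e') =
                   face (T e) (common_vertices (T e) (T e'))].

Definition mesh_size (M : nat) (T : 'I_M -> simplex) : R :=
  \big[Num.max/0]_(e < M) diam (hull (T e)).

Definition shape_regular (sigma : R) (M : nat) (T : 'I_M -> simplex) : Prop :=
  forall e, exists x, eball x (diam (hull (T e)) / sigma) `<=` hull (T e).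

(* Subdomains are given by sets of elements; [elements T W] is the closed
   union, and also the closure of the open subdomain [region T W]. *)
Definition elements (M : nat) (T : 'I_M -> simplex) (W : {set 'I_M}) : set pt :=
  [set x | exists2 e, e \in W & hull (T e) x].

Definition region (M : nat) (T : 'I_M -> simplex) (W : {set 'I_M}) : set pt :=
  (elements T W)°.

(* all the elements touching the subdomain (those of W included) *)
Definition add_layer (M : nat) (T : 'I_M -> simplex) (W : {set 'I_M}) :
    {set 'I_M} :=
  finset (fun e => `[< hull (T e) `&` elements T W !=set0 >]).

Definition polynomial_of_degree (p : nat) (f : pt -> C) : Prop :=
  exists c : {ffun 'I_d -> 'I_p.+1} -> C, forall x,
    f x = \sum_(al : {ffun 'I_d -> 'I_p.+1} | (\sum_j al j <= p)%N)
            c al * (\prod_j x 0 j ^+ al j)%:C.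

(* Functions of the finite element spaces are extended by 0 outside the closure
   of their domain, so that they are equal as soon as they agree there. *)
Definition Uh (Om : set pt) (p M : nat) (T : 'I_M -> simplex) : set (pt -> C) :=
  [set u | [/\ {within closure Om, continuous (fun x => complex.Re (u x))},
               {within closure Om, continuous (fun x => complex.Im (u x))},
               forall e, exists2 q, polynomial_of_degree p q &
                           forall x, hull (T e) x -> u x = q x &
               forall x, ~ closure Om x -> u x = 0]].

Section LocalSpaces.
Context (Om : set pt) (k : R) (p M : nat) (T : 'I_M -> simplex).
Context (W : {set 'I_M}).
Local Notation w := (region T W).

Definition Uh_loc : set (pt -> C) :=
  [set v | exists2 u, Uh Om p T u & v = patch (cst 0) (closure w) u].

Definition Uh_loc0 : set (pt -> C) :=
  [set v | Uh_loc v /\ forall x, (boundary w `&` Om) x -> v x = 0].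

Definition Uh_locB : set (pt -> C) :=
  [set u | Uh_loc u /\ forall v, Uh_loc0 v -> helmB Om k w u v = 0].

(* Lagrange node of K with barycentric coordinates al / p *)
Definition node (K : simplex) (al : {ffun 'I_d.+1 -> 'I_p.+1}) : pt :=
  \sum_l ((al l)%:R / p%:R) *: K l.

(* nodal interpolant on the subdomain, the unique element of the set *)
Definition interpolant (f : pt -> C) : pt -> C :=
  xget (cst 0) [set v | Uh_loc v /\
    forall e (al : {ffun 'I_d.+1 -> 'I_p.+1}), e \in W -> (\sum_l al l)%N = p ->
      v (node (T e) al) = f (node (T e) al)].

(* left-hand side of the local eigenproblem, chi a partition function *)
Definition eig_lhs (chi : pt -> R) (phi v : pt -> C) : C :=
  helmAk k w (interpolant (fun x => (chi x)%:C * phi x))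
             (interpolant (fun x => (chi x)%:C * v x)).

Definition inf_sup : \bar R :=
  ereal_inf [set ereal_sup
      [set (cabs (helmBimp Om k w v u) / (normAk k w v * normAk k w u))%:E
        | u in [set u | Uh_loc u /\ u <> cst 0]]
    | v in [set v | Uh_loc v /\ v <> cst 0]].

End LocalSpaces.

(* [lam] lists in nonincreasing order, with multiplicity, the eigenvalues of
   the problem a(phi, v) = lambda b(phi, v) for all v in the space U: there is
   a basis of U consisting of corresponding eigenvectors. *)
Definition eigenvalues (U : set (pt -> C)) (a b : (pt -> C) -> (pt -> C) -> C)
    (lam : seq R) : Prop :=
  sorted >=%R lam /\
  exists phi : 'I_(size lam) -> pt -> C,
    [/\ forall l, U (phi l),
        forall l v, U v -> a (phi l) v = (nth 0 lam l)%:C * b (phi l) v,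
        forall c : 'I_(size lam) -> C,
          (forall x, \sum_l c l * phi l x = 0) -> forall l, c l = 0 &
        forall u, U u -> exists c : 'I_(size lam) -> C,
          forall x, u x = \sum_l c l * phi l x].

(* One member of the family of discretizations. [eigs i] lists the local
   eigenvalues and [cstab_loc i] is the local stability constant; the
   properties of the fields are stated in the predicates below. *)
Record config := Config {
  wavenumber : R;
  nelem : nat;
  mesh : 'I_nelem -> simplex;
  nsub : nat;
  sub_elems : 'I_nsub -> {set 'I_nelem};
  nlayers : 'I_nsub -> nat;
  pou : 'I_nsub -> pt -> R;
  eigs : 'I_nsub -> seq R;
  nmodes : 'I_nsub -> nat;
  cstab_loc : 'I_nsub -> R }.

Section Config.
Context (Om : set pt) (p : nat) (c : config).
Local Notation k := (wavenumber c).
Local Notation T := (@mesh c).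
Local Notation I := 'I_(nsub c).

Definition hmesh : R := mesh_size T.

Definition over_elems (i : I) : {set 'I_(nelem c)} :=
  iter (nlayers i) (add_layer T) (sub_elems i).

Definition om (i : I) : set pt := region T (sub_elems i).
Definition om_star (i : I) : set pt := region T (over_elems i).
Definition om_star_tilde (i : I) : set pt :=
  region T (add_layer T (over_elems i)).

Definition Hstar (i : I) : R := diam (om_star i).

Definition overlap (w : I -> set pt) : nat :=
  \max_(S : {set I} | `[< exists2 x, Om x & S = finset (fun i => `[< w i x >]) >])
    #|S|.

Definition xi : nat := overlap om.
Definition xi_star_tilde : nat := overlap om_star_tilde.

(* eigenvalues are numbered from 1 in the mathematical notation, from 0 in
   [eigs]: this is lambda_{h,i,n_i+1} *)
Definition lambda (i : I) : R := nth 0 (eigs i) (nmodes i).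

Definition lambda_max : R := \big[Num.max/0]_(i < nsub c) lambda i.

Definition decomposition : Prop :=
  Om = \bigcup_i om i /\
  forall i : I, (0 < nlayers i)%N /\ lipschitz_set (om_star i).

(* nodal interpolation needs point values of the partition functions, hence
   the continuity requirement *)
Definition partition_of_unity (Cchi : R) : Prop :=
  (forall x, closure Om x -> \sum_(i < nsub c) pou i x = 1) /\
  forall i : I,
    [/\ forall x, 0 <= pou i x <= 1,
        {within closure Om, continuous (pou i)},
        closure [set x | pou i x != 0] `<=` closure (om i) &
        exists2 g, is_grad (om i) (fun x => (pou i x)%:C) g &
          forall x, om i x ->
            Num.sqrt (\sum_j cabs (g x j) ^+ 2) <= Cchi / diam (om i)].

Definition local_eigenvalues : Prop :=
  forall i : I,
    eigenvalues (Uh_locB Om k p T (over_elems i))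
      (eig_lhs Om k p T (over_elems i) (pou i))
      (helmA (om_star i))
      (eigs i).

Record discretization (sigma Cchi : R) : Prop := {
  wavenumber_gt0 : 0 < k;
  mesh_triangulation : triangulation Om T;
  mesh_regular : shape_regular sigma T;
  subdomains : decomposition;
  pou_partition : partition_of_unity Cchi;
  eigenproblems : local_eigenvalues }.

Definition bounded_form (CB : R) : Prop :=
  forall u v, H1 Om u -> H1 Om v ->
    cabs (helmB Om k Om u v) <= CB * (normAk k Om u * normAk k Om v).

Definition stability_constant (Cs : R) : Prop :=
  forall f u, L2 (@leb R d) Om f -> H1 Om u ->
    (forall v, H1 Om v ->
       helmB Om k Om u v = cint (@leb R d) Om (fun x => f x * (v x)^*)) ->
    normAk k Om u <= Cs * L2norm (@leb R d) Om f.

Definition local_inf_sup (c0 : R) : Prop :=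
  forall i : I,
    ((c0 / (1 + k * cstab_loc i))%:E <= inf_sup Om k p T (over_elems i))%E.

Definition Lambda_bound (CB : R) : R :=
  Num.sqrt (xi%:R * xi_star_tilde%:R) * CB * (k * hmesh) `^ (- 2^-1) *
  \big[Num.max/0]_(i < nsub c)
    ((1 + k * cstab_loc i) * (1 + (k * Hstar i)^-1) `^ (3 / 2) *
     Num.sqrt (lambda i)).

End Config.
End Sobolev.

(* Main.v *)
Require Import Defs.
From HB Require Import structures.
From mathcomp Require Import all_boot all_order all_algebra.
From mathcomp Require Import all_classical all_reals all_analysis.
From mathcomp Require Import complex ring.

Set Implicit Arguments.
Unset Strict Implicit.
Unset Printing Implicit Defensive.

Import Order.TTheory GRing.Theory Num.Theory.
Import numFieldNormedType.Exports.

Local Open Scope classical_set_scope.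
Local Open Scope ring_scope.

(** Write k for the wavenumber; the estimate is a computation with orders of
    magnitude in k.  Every ingredient of the bound is asymptotic to a power of k
    with constants uniform over the family of discretizations:
    - the overlap numbers are bounded by assumption, and at least 1 because some
      point of the nonempty domain lies in some subdomain, hence also in the
      corresponding enlarged one ([om_sub_tilde], [overlap_gt0]); so the factor
      with the square root is of order 1;
    - k h is asymptotic to k^(-gamma), so (k h)^(-1/2) gives k^(gamma/2);
    - k H_i^* and k C_stab,i(k) are of order 1, so the first two factors in the
      maximum are of order 1;
    - C_stab(k) is of order 1 on a star-shaped domain, so the square roots of
      the eigenvalues, and that of lambda_max, are asymptotic to k^(-1).
    Hence Lambda, k^(gamma/2) lambda_max^(1/2) and
    (lambda_max^(1/2))^(1-gamma/2) are all asymptotic to k^(-1+gamma/2), and the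
    three claims follow by transitivity.

    The constants in these relations are uniform in the subdomain as well as in
    the discretization: local quantities are functions on the dependent sum of
    the index sets of subdomains, and [asymp_bigmax] turns a relation on that
    sum into one for the maxima over the subdomains.  This needs at least one
    subdomain for each discretization, as an empty maximum is 0. *)

(** * Calculus of asymptotic equivalence *)

Section AsympCalculus.
Context (R : realType).
Implicit Types I : Type.

Lemma lesssim_refl I (a : I -> R) : lesssim a a.
Proof. by exists 1 => // i; rewrite mul1r. Qed.

Lemma lesssim_trans I (b a c : I -> R) :
  lesssim a b -> lesssim b c -> lesssim a c.
Proof.
move=> [C C0 ab] [D D0 bc]; exists (C * D); first exact: mulr_gt0.
by move=> i; rewrite -mulrA (le_trans (ab i))// ler_pM2l.
Qed.

Lemma asymp_refl I (a : I -> R) : asymp a a.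
Proof. by split; exact: lesssim_refl. Qed.

Lemma eq_asymp I (a b a' b' : I -> R) :
  a =1 a' -> b =1 b' -> asymp a b -> asymp a' b'.
Proof. by move=> /funext -> /funext ->. Qed.

Lemma asymp_sym I (a b : I -> R) : asymp a b -> asymp b a.
Proof. by case. Qed.

Lemma asymp_trans I (b a c : I -> R) : asymp a b -> asymp b c -> asymp a c.
Proof.
by move=> [ab ba] [bc cb]; split; [exact: lesssim_trans ab bc|
  exact: lesssim_trans cb ba].
Qed.

Lemma asymp_comp I I' (f : I' -> I) (a b : I -> R) :
  asymp a b -> asymp (fun i => a (f i)) (fun i => b (f i)).
Proof. by move=> [[C C0 ab] [D D0 ba]]; split; [exists C|exists D]. Qed.

(** Equivalence transfers positivity from right to left, so that the
    multiplicative rules below ask for it on the right-hand sides only, which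
    are explicit powers of k or constants in the applications. *)
Lemma asymp_gt0 I (a b : I -> R) :
  asymp a b -> (forall i, 0 < b i) -> forall i, 0 < a i.
Proof.
by move=> [_ [D D0 ba]] b0 i; rewrite -(pmulr_rgt0 _ D0) (lt_le_trans (b0 i)).
Qed.

Lemma lesssimM I (a b a' b' : I -> R) :
  (forall i, 0 <= a i) -> (forall i, 0 <= a' i) ->
  lesssim a b -> lesssim a' b' ->
  lesssim (fun i => a i * a' i) (fun i => b i * b' i).
Proof.
move=> a0 a'0 [C C0 ab] [D D0 ab']; exists (C * D); first exact: mulr_gt0.
by move=> i; rewrite mulrACA ler_pM.
Qed.

Lemma asympM I (a b a' b' : I -> R) :
  (forall i, 0 < b i) -> (forall i, 0 < b' i) ->
  asymp a b -> asymp a' b' ->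
  asymp (fun i => a i * a' i) (fun i => b i * b' i).
Proof.
move=> b0 b'0 ab ab'.
have a0 := asymp_gt0 ab b0; have a'0 := asymp_gt0 ab' b'0.
case: ab ab' => [ab ba] [ab' ba'].
by split; apply: lesssimM => // i; exact: ltW.
Qed.

Lemma lesssim_powR I (a b : I -> R) (r : R) : 0 <= r ->
  (forall i, 0 <= a i) -> (forall i, 0 <= b i) ->
  lesssim a b -> lesssim (fun i => a i `^ r) (fun i => b i `^ r).
Proof.
move=> r0 a0 b0 [C C0 ab]; exists (C `^ r); first exact: powR_gt0.
move=> i; rewrite -powRM ?(ltW C0)// ge0_ler_powR// nnegrE//.
by rewrite mulr_ge0// ltW.
Qed.

Lemma lesssimV I (a b : I -> R) : (forall i, 0 < a i) ->
  (forall i, 0 < b i) ->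
  lesssim a b -> lesssim (fun i => (b i)^-1) (fun i => (a i)^-1).
Proof.
move=> a0 b0 [C C0 ab]; exists C => // i.
by rewrite ler_pdivlMr// mulrC ler_pdivrMr.
Qed.

(** The sign of the exponent decides whether the two inequalities keep their
    roles or exchange them. *)
Lemma asymp_powR I (a b : I -> R) (r : R) : (forall i, 0 < b i) ->
  asymp a b -> asymp (fun i => a i `^ r) (fun i => b i `^ r).
Proof.
move=> b0 ab; have a0 := asymp_gt0 ab b0; case: ab => ab ba.
suff mono u v : (forall i, 0 < u i) -> (forall i, 0 < v i) ->
    lesssim u v -> lesssim v u ->
    lesssim (fun i => u i `^ r) (fun i : I => v i `^ r).
  by split; exact: mono.
move=> u0 v0 uv vu; have [r0|r0] := leP 0 r.
  by apply: lesssim_powR => // i; exact: ltW.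
have := lesssim_powR (_ : 0 <= - r) _ _ vu.
rewrite oppr_ge0 => /(_ (ltW r0) (fun i => ltW (v0 i)) (fun i => ltW (u0 i))) vu'.
have [C C0 H] := lesssimV (fun i => powR_gt0 (- r) (v0 i))
  (fun i => powR_gt0 (- r) (u0 i)) vu'.
by exists C => // i; have := H i; rewrite -!powRN opprK.
Qed.

Lemma asymp1D I (a : I -> R) : (forall i, 0 < a i) -> asymp a (fun=> 1) ->
  asymp (fun i => 1 + a i) (fun=> 1).
Proof.
move=> a0 [[C C0 aC] _]; split.
  exists (1 + C); first by rewrite addr_gt0.
  by move=> i; rewrite mulr1 lerD2l -[C]mulr1.
by exists 1 => // i; rewrite mul1r lerDl ltW.
Qed.

(** The maximum is bounded above termwise with the uniform constant, and below by
    any one of its terms, the first one say. *)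
Lemma asymp_bigmax I (n : I -> nat) (F : forall i, 'I_(n i) -> R) (g : I -> R) :
  (forall i, 0 < n i)%N -> (forall i, 0 < g i) ->
  asymp (fun s : {i : I & 'I_(n i)} => F (tag s) (tagged s))
        (fun s => g (tag s)) ->
  asymp (fun i => \big[Num.max/0]_(l < n i) F i l) g.
Proof.
move=> n0 g0 [[C C0 Fg] [D D0 gF]]; split.
  exists C => // i; apply: bigmax_le; first by rewrite mulr_ge0 ?ltW.
  by move=> l _; exact: (Fg (existT _ i l)).
exists D => // i; apply: (le_trans (gF (existT _ i (Ordinal (n0 i))))) => /=.
by rewrite ler_pM2l//; apply: (le_bigmax _ (F i)).
Qed.

End AsympCalculus.

(** * Positivity of the overlap numbers *)

Section Overlap.
Context (R : realType) (d : nat).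

(** An element contains its vertices, so its hull meets the union it belongs
    to. *)
Lemma sub_add_layer M (T : 'I_M -> simplex R d) (W : {set 'I_M}) :
  (W \subset add_layer T W)%SET.
Proof.
apply/fintype.subsetP => e eW; rewrite inE; apply/asboolP; exists (T e ord0).
suff v : hull (T e) (T e ord0) by split=> //; exists e.
exists (fun l => (l == ord0)%:R); split=> //.
- by rewrite (bigD1 ord0)//= big1 ?addr0// => l /negbTE ->.
- by move=> l; rewrite inE.
- by rewrite (bigD1 ord0)//= scale1r big1 ?addr0// => l /negbTE ->; rewrite scale0r.
Qed.

Lemma region_mono M (T : 'I_M -> simplex R d) (W W' : {set 'I_M}) :
  (W \subset W')%SET -> region T W `<=` region T W'.
Proof.
move=> /fintype.subsetP WW'; apply: interiorS => x [e eW ex].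
by exists e => //; exact: WW'.
Qed.

Lemma om_sub_tilde (c : config R d) (i : 'I_(nsub c)) : om i `<=` om_star_tilde i.
Proof.
apply: region_mono; rewrite /over_elems.
apply: (fintype.subset_trans _ (sub_add_layer _ _)).
elim: (nlayers i) => //= n IH; exact: (fintype.subset_trans IH (sub_add_layer _ _)).
Qed.

Lemma overlap_gt0 (Om : set 'rV[R]_d) (c : config R d)
    (w : 'I_(nsub c) -> set 'rV[R]_d) x i :
  Om x -> w i x -> (0 < overlap Om w)%N.
Proof.
move=> Ox wx.
pose S : {set 'I_(nsub c)} := finset (fun i => `[< w i x >]).
rewrite /overlap; apply: (@leq_trans #|S|).
  by apply/card_gt0P; exists i; rewrite inE; apply/asboolP.
apply: (@leq_bigmax_cond _ _ (fun S : {set 'I_(nsub c)} => #|S|)).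
by apply/asboolP; exists x.
Qed.

End Overlap.

(** * Orders of magnitude in the wavenumber *)

Theorem mainTheorem3 (R : realType) (d p : nat) (Om : set 'rV[R]_d)
    (J : Type) (c : J -> config R d)
    (sigma Cchi CB : R) (Cstab h0 : R -> R) (gamma : R) (Lam : J -> R)
    (k := fun j => wavenumber (c j)) (h := fun j => hmesh (c j))
    (sub := {j : J & 'I_(nsub (c j))})
    (dim23 : d = 2%N \/ d = 3%N) (p_gt0 : (0 < p)%N)
    (domOm : polygonal_lipschitz_domain Om)
    (sigma_gt0 : 0 < sigma)
    (discr : forall j, discretization Om p (c j) sigma Cchi)
    (xi_bounded : exists m : nat, forall j,
       (xi Om (c j) <= m)%N /\ (xi_star_tilde Om (c j) <= m)%N)
    (CB_gt0 : 0 < CB) (CB_bound : forall j, bounded_form Om (c j) CB)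
    (Cstab_gt0 : forall j, 0 < Cstab (k j))
    (Cstab_bound : forall j, stability_constant Om (c j) (Cstab (k j)))
    (Cstab_star : star_shaped_wrt_ball Om ->
       asymp (fun j => Cstab (k j)) (fun=> 1))
    (cstab_loc_gt0 : forall j (i : 'I_(nsub (c j))), 0 < cstab_loc i)
    (h0_gt0 : forall j, 0 < h0 (k j))
    (cstab_loc_inf_sup : exists2 c0 : R, 0 < c0 &
       forall j, h j < h0 (k j) -> local_inf_sup Om p (c j) c0)
    (cstab_loc_Hstar :
       asymp (fun s : sub => Hstar (tagged s)) (fun s => (k (tag s))^-1) ->
       asymp (fun s : sub => cstab_loc (tagged s)) (fun s => (k (tag s))^-1))
    (Om_star : star_shaped_wrt_ball Om)
    (gamma_range : 0 < gamma <= 1)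
    (h_k : asymp h (fun j => k j `^ (- (1 + gamma))))
    (lambda_k : asymp (fun s : sub => Num.sqrt (lambda (tagged s)))
                      (fun s => (k (tag s) * Cstab (k (tag s)))^-1))
    (Hstar_k : asymp (fun s : sub => Hstar (tagged s))
                     (fun s => (k (tag s))^-1))
    (Lam_def : asymp Lam (fun j => Lambda_bound Om (c j) CB)) :
  [/\ asymp Lam (fun j => k j `^ (gamma / 2) * Num.sqrt (lambda_max (c j))),
      asymp (fun j => k j `^ (gamma / 2) * Num.sqrt (lambda_max (c j)))
            (fun j => Num.sqrt (lambda_max (c j)) `^ (1 - gamma / 2)) &
      asymp (fun j => Num.sqrt (lambda_max (c j)) `^ (1 - gamma / 2))
            (fun j => k j `^ (- 1 + gamma / 2))].
Proof.
have k0 j : 0 < k j := wavenumber_gt0 (discr j).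
have kV0 j : 0 < (k j)^-1 by rewrite invr_gt0.
have overlaps j : [/\ (0 < nsub (c j))%N, (0 < xi Om (c j))%N &
    (0 < xi_star_tilde Om (c j))%N].
  have [[x Ox] _ _ _] := domOm.
  have [cov _] := subdomains (discr j).
  have := Ox; rewrite [in X in X -> _]cov => -[i _ ix].
  split; first exact: leq_ltn_trans (ltn_ord i).
    exact: overlap_gt0 ix.
  by apply: (overlap_gt0 Ox); exact: om_sub_tilde ix.
have nsub0 j : (0 < nsub (c j))%N by case: (overlaps j).
have xi1 : asymp (fun j => Num.sqrt ((xi Om (c j))%:R * (xi_star_tilde Om (c j))%:R))
                 (fun=> 1 : R).
  have [m mP] := xi_bounded; split.
    exists m.+1%:R => // j; rewrite mulr1 -[leRHS]ger0_norm// -sqrtr_sqr.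
    rewrite ler_wsqrtr// expr2 ler_pM// ler_nat; have [a b] := mP j; exact: leqW.
  exists 1 => // j; rewrite mul1r -[leLHS]sqrtr1 ler_wsqrtr//.
  by rewrite -natrM ler1n muln_gt0; case: (overlaps j) => _ -> ->.
(* puts the two hypotheses on local quantities of size 1/k in the form in
   which they enter the bound *)
have kk1 (a : sub -> R) : asymp a (fun s => (k (tag s))^-1) ->
    asymp (fun s => k (tag s) * a s) (fun=> 1).
  move=> /(asympM (fun s => k0 (tag s)) (fun s => kV0 (tag s)) (asymp_refl _)).
  by apply: eq_asymp => // s; rewrite divff ?gt_eqF.
have pos1 (s : sub) : 0 < 1 :> R by [].
have kcs := kk1 _ (cstab_loc_Hstar Hstar_k).
have kH := kk1 _ Hstar_k.
have kHV : asymp (fun s : sub => (k (tag s) * Hstar (tagged s))^-1) (fun=> 1).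
  apply: eq_asymp (asymp_powR (-1) pos1 kH) => s; last by rewrite powR1.
  by rewrite powR_inv1// ltW// (asymp_gt0 kH pos1).
have sqrt_lambda : asymp (fun s : sub => Num.sqrt (lambda (tagged s)))
    (fun s => (k (tag s))^-1).
  apply: asymp_trans lambda_k _.
  have kC := asympM k0 (fun=> ltr01) (asymp_refl k) (Cstab_star Om_star).
  have kC0 j : 0 < k j * 1 by rewrite mulr1.
  have := asymp_comp (fun s : sub => tag s) (asymp_powR (-1) kC0 kC).
  by apply: eq_asymp => s; rewrite powR_inv1 ?mulr1// ltW// mulr_gt0.
have sqrt_gt0 := asymp_gt0 sqrt_lambda (fun s => kV0 (tag s)).
have kVV0 j : 0 < (k j)^-1 * (k j)^-1 by rewrite mulr_gt0.
(* the maximum is taken over the eigenvalues themselves, hence the passage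
   through their squared square roots *)
have lmax2 : asymp (fun j => lambda_max (c j)) (fun j => (k j)^-1 * (k j)^-1).
  apply: (@asymp_bigmax _ _ (fun j => nsub (c j)) (fun j i => lambda i)) => //.
  have := asympM (fun s : sub => kV0 (tag s)) (fun s => kV0 (tag s))
    sqrt_lambda sqrt_lambda.
  apply: eq_asymp => // s.
  by rewrite -expr2 sqr_sqrtr// ltW// -sqrtr_gt0.
have lmax : asymp (fun j => Num.sqrt (lambda_max (c j))) (fun j => (k j)^-1).
  apply: eq_asymp (asymp_powR 2^-1 kVV0 lmax2) => j.
    by rewrite powR12_sqrt// ltW// (asymp_gt0 lmax2 kVV0).
  by rewrite powR12_sqrt ?ltW// -expr2 sqrtr_sqr gtr0_norm.
have maxfactor : asymp (fun j => \big[Num.max/0]_(i < nsub (c j))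
    ((1 + k j * cstab_loc i) * (1 + (k j * Hstar i)^-1) `^ (3 / 2) *
     Num.sqrt (lambda i))) (fun j => (k j)^-1).
  apply: (@asymp_bigmax _ _ (fun j => nsub (c j)) (fun j i =>
    (1 + k j * cstab_loc i) * (1 + (k j * Hstar i)^-1) `^ (3 / 2) *
     Num.sqrt (lambda i))) => //.
  have f1 := asymp1D (asymp_gt0 kcs pos1) kcs.
  have f2 := asymp_powR (3 / 2) pos1 (asymp1D (asymp_gt0 kHV pos1) kHV).
  rewrite powR1 in f2.
  have p11 (s : sub) : 0 < 1 * 1 :> R by rewrite mulr1.
  apply: eq_asymp (asympM p11 (fun s => kV0 (tag s)) (asympM pos1 pos1 f1 f2)
    sqrt_lambda) => // s.
  by rewrite !mul1r.
have khfactor : asymp (fun j => (k j * h j) `^ (- 2^-1))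
    (fun j => k j `^ (gamma / 2)).
  have p0 j : 0 < k j `^ (- (1 + gamma)) by rewrite powR_gt0.
  have kp0 j : 0 < k j * k j `^ (- (1 + gamma)) by rewrite mulr_gt0.
  apply: eq_asymp (asymp_powR (- 2^-1) kp0
    (asympM k0 p0 (asymp_refl k) h_k)) => // j.
  rewrite -{1}[k j]powRr1 ?ltW// -powRD; last first.
    by apply/implyP => _; rewrite gt_eqF.
  by rewrite -powRrM; congr (_ `^ _); field.
have target j : k j `^ (gamma / 2) * (k j)^-1 = k j `^ (- 1 + gamma / 2).
  rewrite -[(k j)^-1]powR_inv1 ?ltW// -powRD 1?addrC//.
  by apply/implyP => _; rewrite gt_eqF.
have kg0 j : 0 < k j `^ (gamma / 2) by rewrite powR_gt0.
have rhs1 : asymp (fun j => k j `^ (gamma / 2) * Num.sqrt (lambda_max (c j)))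
    (fun j => k j `^ (- 1 + gamma / 2)).
  exact: eq_asymp (fun=> erefl) target (asympM kg0 kV0 (asymp_refl _) lmax).
have rhs2 : asymp (fun j => Num.sqrt (lambda_max (c j)) `^ (1 - gamma / 2))
    (fun j => k j `^ (- 1 + gamma / 2)).
  apply: eq_asymp (asymp_powR (1 - gamma / 2) kV0 lmax) => // j.
  by rewrite -[(k j)^-1]powR_inv1 ?ltW// -powRrM mulN1r opprB addrC.
have CB1 : asymp (fun=> CB) (fun _ : J => 1).
  split; [exists CB|exists CB^-1]; rewrite ?invr_gt0// => j.
    by rewrite mulr1.
  by rewrite mulVf ?gt_eqF.
have rhs0 : asymp Lam (fun j => k j `^ (- 1 + gamma / 2)).
  apply: asymp_trans Lam_def _.
  have one (j : J) : 0 < 1 :> R by [].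
  have p11 (j : J) : 0 < 1 * 1 :> R by rewrite mulr1.
  have pkg j : 0 < 1 * 1 * k j `^ (gamma / 2) by rewrite !mul1r.
  apply: eq_asymp (asympM pkg kV0 (asympM p11 kg0 (asympM one one xi1 CB1)
    khfactor) maxfactor) => // j.
  by rewrite !mul1r target.
split=> //.
- exact: asymp_trans rhs0 (asymp_sym rhs1).
- exact: asymp_trans rhs1 (asymp_sym rhs2).
Qed.
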